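(* Let $X_1, X_2, \ldots$ be independent and identically distributed real-valued random variables having mean $0$ and variance $1$, and let $Z$ be a standard normal random variable. Then \[ \lim_{n\to\infty} \mathbf{P}\left(\frac{X_1+\cdots+X_n}{\sqrt{n}} \le x\right) = \mathbf{P}(Z \le x) \qquad \text{for all } x \in \mathbf{R}. \]
   Context: A standard normal random variable $Z$ is a continuous real-valued random variable with density $f_Z(t) = \frac{e^{-t^2/2}}{\sqrt{2\pi}}$ for all $t \in \mathbf{R}$. $\mathbf{P}$ denotes probability. *)

(* Defs.v *)
From HB Require Import structures.
From mathcomp Require Export all_boot all_order all_algebra.
From mathcomp Require Export finmap.
From mathcomp Require Export all_classical all_reals all_analysis.

Set Implicit Arguments.
Unset Strict Implicit.
Unset Printing Implicit Defensive.

Import Order.TTheory GRing.Theory Num.Theory.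
Import numFieldNormedType.Exports.

Local Open Scope classical_set_scope.
Local Open Scope ring_scope.

(* Mutual (not merely pairwise) independence: the product rule for every finite
   subfamily. *)
Definition mutually_independent (d d' : measure_display)
    (T : measurableType d) (T' : measurableType d') (R : realType)
    (P : probability T R) (I : choiceType) (X : I -> {RV P >-> T'}) : Prop :=
  forall (J : {fset I}) (B : I -> set T'),
    (forall i, i \in J -> measurable (B i)) ->
    P (\bigcap_(i in [set` J]) X i @^-1` B i)
      = (\prod_(i <- J) P (X i @^-1` B i))%E.

(* Laws are compared on measurable sets only: a term of type [probability T R]
   is unconstrained on the other sets. *)
Definition identically_distributed (d d' : measure_display)
    (T : measurableType d) (T' : measurableType d') (R : realType)
    (P : probability T R) (I : Type) (X : I -> {RV P >-> T'}) : Prop :=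
  forall (i j : I) (B : set T'), measurable B ->
    distribution P (X i) B = distribution P (X j) B.

Definition has_density (d : measure_display) (T : measurableType d)
    (R : realType) (P : probability T R) (Z : {RV P >-> R}) (f : R -> R)
    : Prop :=
  forall B : set R, measurable B ->
    distribution P Z B = (\int[lebesgue_measure]_(t in B) (f t)%:E)%E.

Definition standard_normal (d : measure_display) (T : measurableType d)
    (R : realType) (P : probability T R) (Z : {RV P >-> R}) : Prop :=
  has_density Z (normal_pdf 0 1).

Lemma normal_pdf01E (R : realType) (t : R) :
  normal_pdf 0 1 t = expR (- (t ^+ 2 / 2)) / Num.sqrt (2 * pi).
Proof.
rewrite normal_pdfE ?oner_neq0// /normal_peak /normal_fun subr0 expr1n mul1r.
by rewrite mulNr mulr_natl [LHS]mulrC.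
Qed.

(* Main.v *)
(** Lindeberg's replacement argument. Let [f] be a smooth test function and
    [T_m f y] the integral of [f (y + t / sqrt n)] against [m (dt)]. Convolution of
    laws becomes composition of these operators, and they commute. If [mu] is the
    law of [X_0] and [g] the standard Gaussian, both have mean 0 and variance 1, so
    a Taylor expansion gives [T_mu f - T_g f = o(1/n)] uniformly; the [n]-fold
    composites therefore differ by [n * o(1/n) = o(1)]. As the Gaussian laws are
    stable under convolution, [T_g^n f 0] is the integral of [f] against [g]. The
    indicator of [u <= x] is finally squeezed between two cubic splines, the
    Gaussian distribution function being Lipschitz. *)

From HB Require Import structures.
Require Import Defs.
From mathcomp Require Import all_boot all_order all_algebra.
From mathcomp Require Import all_classical all_reals all_analysis.
From mathcomp Require Import measurable_realfun ring lra.

Set Implicit Arguments.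
Unset Strict Implicit.
Unset Printing Implicit Defensive.

Import Order.TTheory GRing.Theory Num.Theory.
Import numFieldNormedType.Exports.

Local Open Scope classical_set_scope.
Local Open Scope ring_scope.

(** * Test functions *)

Definition pos_cube {R : realType} (u : R) := Num.max u 0 ^+ 3.

Lemma pos_cubeE {R : realType} (u : R) :
  pos_cube u = if 0 <= u then u ^+ 3 else 0.
Proof.
rewrite /pos_cube; case: ifPn => [u0|]; first by rewrite (max_idPl u0).
by rewrite -ltNge => /ltW u0; rewrite (max_idPr u0) expr0n.
Qed.

(** The second derivative [6 * Num.max y 0] is 6-Lipschitz, whence a remainder of at most [6 / 3!]
    times the cube of [|t|]. The sign patterns of [y] and [y + t] make the remainder explicit. *)
Lemma taylor_pos_cube {R : realType} (y t : R) :
  `|pos_cube (y + t) - pos_cube y - t * (3 * Num.max y 0 ^+ 2)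
    - t ^+ 2 / 2 * (6 * Num.max y 0)| <= `|t| ^+ 3.
Proof.
rewrite !pos_cubeE.
have [y0|y0] := leP 0 y; have [yt0|yt0] := leP 0 (y + t).
- rewrite (_ : _ - _ = t ^+ 3); first by rewrite normrX.
  by field.
- have t0 : t < 0 by lra.
  (* Here [pos_cube (y + t)] vanishes, and the remainder lies between [- (- t) ^+ 3] and 0. *)
  rewrite (ltr0_norm t0) (_ : _ - _ = (- t - y) ^+ 3 - (- t) ^+ 3); last by field.
  have u0 : 0 <= - t - y by lra.
  have ut : - t - y <= - t by lra.
  have : (- t - y) ^+ 3 <= (- t) ^+ 3.
    by rewrite lerXn2r ?nnegrE//; exact: le_trans u0 ut.
  by have := exprn_ge0 3 u0; rewrite ler_norml; lra.
- have yt : y + t <= t by lra.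
  rewrite (_ : _ - _ = (y + t) ^+ 3); last by field.
  rewrite ger0_norm ?exprn_ge0// lerXn2r ?nnegrE//.
  exact: le_trans yt (ler_norm t).
- by rewrite (_ : _ - _ = 0); [rewrite normr0 exprn_ge0|field].
Qed.

Lemma continuous_pos_cube {R : realType} : continuous (@pos_cube R).
Proof.
move=> u; apply: (@continuous_comp _ _ _ (fun u : R => Num.max u 0) (fun u : R => u ^+ 3)).
  by apply: continuous_max; [exact: cvg_id|exact: cvg_cst].
exact: exprn_continuous.
Qed.

(* The cumulative distribution function of the uniform B-spline on [0, 3]. *)
Definition spline {R : realType} (u : R) :=
  (pos_cube u - 3 * pos_cube (u - 1) + 3 * pos_cube (u - 2) - pos_cube (u - 3)) / 6.

Lemma spline_le0 {R : realType} (u : R) : u <= 0 -> spline u = 0.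
Proof.
move=> u0; have un (a : R) : 0 < a -> (0 <= u - a) = false.
  by move=> a0; apply/negbTE; rewrite -ltNge; lra.
rewrite /spline !pos_cubeE !un//.
by case: ifPn => [?|_]; [have -> : u = 0 by lra|]; field.
Qed.

(** No cube is truncated any more, and the third difference of [u ^+ 3] is [3!]. *)
Lemma spline_ge3 {R : realType} (u : R) : 3 <= u -> spline u = 1.
Proof.
move=> u3; rewrite /spline !pos_cubeE.
by rewrite !ifT; [field|lra|lra|lra|lra].
Qed.

Lemma spline01 {R : realType} (u : R) : 0 <= spline u <= 1.
Proof.
have [/spline_le0 ->|u0] := leP u 0; first by rewrite lexx ler01.
have [/spline_ge3 ->|u3] := leP 3 u; first by rewrite lexx ler01.
rewrite /spline !pos_cubeE (ltW u0) [0 <= u - 3]leNgt subr_lt0 u3 /= subr0.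
have [u1|u1] := leP 0 (u - 1); have [u2|u2] := leP 0 (u - 2); try lra.
- have v0 : 0 <= 3 - u by lra.
  have v1 : 3 - u <= 1 by lra.
  (* On [2, 3] this is the symmetry [spline u = 1 - spline (3 - u)]. *)
  rewrite (_ : _ / 6 = 1 - (3 - u) ^+ 3 / 6); last by field.
  by have := exprn_ge0 3 v0; have := exprn_ile1 3 v0 v1; lra.
(* On [1, 2] the numerator becomes a sum of nonnegative terms; [(u - 1) ^+ 2 <= 1] bounds it from
   above. *)
- rewrite (_ : _ / 6 = (1 + 3 * (u - 1) + (u - 1) ^+ 2
    + 2 * ((u - 1) ^+ 2 * (2 - u))) / 6); last by field.
  have v1 : u - 1 <= 1 by lra.
  have w0 : 0 <= 2 - u by lra.
  have v2 : (u - 1) ^+ 2 <= 1 by rewrite exprn_ile1.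
  have := sqr_ge0 (u - 1).
  have := mulr_ge0 (sqr_ge0 (u - 1)) w0; have := ler_wpM2r w0 v2.
  by lra.
- have w0 := ltW u0; have w1 : u <= 1 by lra.
  by have := exprn_ge0 3 w0; have := exprn_ile1 3 w0 w1; lra.
Qed.

Lemma continuous_spline {R : realType} : continuous (@spline R).
Proof.
have cs (a : R) : continuous (fun u : R => pos_cube (u - a)).
  move=> u; apply: (@continuous_comp _ _ _ (fun u : R => u - a) pos_cube).
    by apply: cvgB; [exact: cvg_id|exact: cvg_cst].
  exact: continuous_pos_cube.
move=> u; apply: cvgMl; apply: cvgB; last exact: cs.
apply: cvgD; last by apply: cvgMr; exact: cs.
apply: cvgB; first exact: continuous_pos_cube.
by apply: cvgMr; exact: cs.
Qed.

(* [f1] and [f2] stand for the first two derivatives; no regularity is required of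
   them, as they are only used pointwise. *)
Definition smooth_test {R : realType} (f : R -> R) :=
  [/\ continuous f, (forall u, 0 <= f u <= 1) &
   exists f1 f2 : R -> R, exists K : R,
   forall y t, `|f (y + t) - f y - t * f1 y - t ^+ 2 / 2 * f2 y|
     <= K * `|t| ^+ 3].

Lemma smooth_test_spline {R : realType} (a b : R) :
  smooth_test (fun u => spline (a * u + b)).
Proof.
split=> [u|u|]; [|exact: spline01|].
  apply: (@continuous_comp _ _ _ (fun u : R => a * u + b) spline).
    by apply: cvgD; [apply: cvgMr; exact: cvg_id|exact: cvg_cst].
  exact: continuous_spline.
(* [g1] and [g2] are the first two derivatives of [pos_cube]; [h] is the linear combination that
   turns [pos_cube] into [spline]. *)
pose g1 (u : R) : R := 3 * Num.max u 0 ^+ 2; pose g2 (u : R) : R := 6 * Num.max u 0.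
pose h (g : R -> R) u : R := (g u - 3 * g (u - 1) + 3 * g (u - 2) - g (u - 3)) / 6.
exists (fun u => a * h g1 (a * u + b)), (fun u => a ^+ 2 * h g2 (a * u + b)).
(* The coefficients 1, -3, 3, -1 have absolute values adding up to 8. *)
exists (8 / 6 * `|a| ^+ 3) => y t.
have -> : 8 / 6 * `|a| ^+ 3 * `|t| ^+ 3 = 8 / 6 * `|a * t| ^+ 3.
  by rewrite normrM; ring.
have -> : a * (y + t) + b = (a * y + b) + a * t by ring.
set v := a * y + b; rewrite /spline /h.
have tg w : `|pos_cube (w + a * t) - pos_cube w - a * t * g1 w
    - (a * t) ^+ 2 / 2 * g2 w| <= `|a * t| ^+ 3 := taylor_pos_cube w (a * t).
have := tg v; have := tg (v - 1); have := tg (v - 2); have := tg (v - 3).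
rewrite ![v - _ + a * t]addrAC; move: g1 g2 (`|a * t| ^+ 3) {tg} => g1 g2 T.
by rewrite !ler_norml; lra.
Qed.

(* Boundedness of [f] and the cubic remainder at [t = 1, -1] bound [f1], [f2]. *)
Lemma smooth_test_taylor {R : realType} (f : R -> R) : smooth_test f ->
  exists f1 f2 : R -> R, exists2 K : R, 0 <= K &
  forall y t, `|f (y + t) - f y - t * f1 y - t ^+ 2 / 2 * f2 y|
     <= K * Num.min (t ^+ 2) (`|t| ^+ 3).
Proof.
move=> [_ f01 [f1 [f2 [K fK]]]]; exists f1, f2.
have K0 : 0 <= K.
  by have := fK 0 1; rewrite normr1 !expr1n mulr1; apply: le_trans.
(* For [|t| >= 1], the increment of [f] and the terms in [f1] and [f2] contribute at most [1],
   [1 + K] and [1 + K] times [t ^+ 2]. *)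
exists (3 * (1 + K)) => [|y t]; first by lra.
have -> : Num.min (t ^+ 2) (`|t| ^+ 3) = Num.min (`|t| ^+ 2) (`|t| ^+ 3).
  by rewrite real_normK ?num_real.
have t0 := normr_ge0 t.
have [t1|/ltW t1] := leP `|t| 1.
  have t23 : `|t| ^+ 3 <= `|t| ^+ 2 by rewrite ler_wiXn2l.
  rewrite (min_idPr t23); apply: le_trans (fK y t) _.
  by rewrite ler_wpM2r ?exprn_ge0//; lra.
have t23 : `|t| ^+ 2 <= `|t| ^+ 3 by rewrite ler_weXn2l.
rewrite (min_idPl t23).
have := fK y 1; have := fK y (-1).
rewrite normrN normr1 sqrrN !expr1n mulr1.
have := f01 y; have := f01 (y + 1); have := f01 (y - 1); have := f01 (y + t).
move: (f y) (f (y + 1)) (f (y - 1)) (f (y + t)) (f1 y) (f2 y).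
move=> a b c e p q e01 c01 b01 a01; rewrite !ler_norml => H1 H2.
(* The difference of the expansions at 1 and -1 isolates [f1 y], their sum isolates [f2 y]. *)
have P : `|p| <= 1 + K by rewrite ler_norml; lra.
have Q : `|q| <= 2 * (1 + K) by rewrite ler_norml; lra.
have E : `|e - a| <= 1 by rewrite ler_norml; lra.
rewrite -ler_norml.
apply: le_trans (ler_normB _ _) _; apply: le_trans (lerD (ler_normB _ _) (lexx _)) _.
have -> : `|t ^+ 2 / 2 * q| = `|t| ^+ 2 / 2 * `|q|.
  by rewrite normrM normrM normfV normrX (ger0_norm (ler0n _ 2)).
rewrite normrM.
have tp : `|t| * `|p| <= `|t| ^+ 2 * (1 + K).
  by rewrite ler_pM// expr2 ler_peMl.
have tq : `|t| ^+ 2 * `|q| <= `|t| ^+ 2 * (2 * (1 + K)).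
  by rewrite ler_wpM2l// exprn_ge0.
have t2 : 1 <= `|t| ^+ 2 by rewrite exprn_ege1.
nra.
Qed.

(** * One-step Taylor estimate *)

Lemma bounded_integrable {R : realType} (mu : probability R R) (f : R -> R) (M : R) :
  measurable_fun setT f -> (forall u, `|f u| <= M) ->
  mu.-integrable setT (EFin \o f).
Proof.
move=> mf fM; apply: measurable_bounded_integrable => //.
  by rewrite (le_lt_trans (probability_le1 mu measurableT))// ltry.
exists M; split; first exact: num_real.
by move=> x Mx u _; apply: le_trans (fM u) _; exact: ltW.
Qed.

Lemma Rintegral_cst_probability {R : realType} (mu : probability R R) (a : R) :
  \int[mu]_u a = a.
Proof.
rewrite Rintegral_cst// -[RHS]mulr1; congr (_ * _).
by rewrite -[RHS]/(fine 1%E); congr fine; exact: probability_setT.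
Qed.

Lemma normr_Rintegral_le {R : realType} (mu : probability R R) (f : R -> R) (M : R) :
  measurable_fun setT f -> (forall u, `|f u| <= M) -> `|\int[mu]_u f u| <= M.
Proof.
move=> mf fM; have fi := bounded_integrable mu mf fM.
apply: le_trans (le_normr_Rintegral measurableT fi) _.
rewrite -[leRHS](Rintegral_cst_probability mu); apply: le_Rintegral => //.
  apply: (@bounded_integrable _ _ _ M) => [|u]; last by rewrite normr_id.
  exact: measurableT_comp.
by apply: (@bounded_integrable _ _ _ `|M|).
Qed.

(** A real-valued integral is 0 by default when the extended one is infinite, so integrability is
    recorded next to the value of the mean. *)
Definition standardized {R : realType} (mu : probability R R) :=
  [/\ mu.-integrable setT (EFin \o id),
      mu.-integrable setT (EFin \o (fun u : R => u ^+ 2)),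
      \int[mu]_u u = 0 & \int[mu]_u (u ^+ 2) = 1].

Lemma measurable_truncated {R : realType} (c : R) :
  measurable_fun setT (fun u : R => Num.min (u ^+ 2) (c * `|u| ^+ 3)).
Proof.
apply: measurable_minr; first exact: measurable_funX.
by apply: measurable_funM => //; apply: measurable_funX; exact: normr_measurable.
Qed.

(** Dominated convergence: the integrand tends to 0 pointwise and is dominated by the integrable
    [u ^+ 2]. The truncation stands in for a third moment, which may be infinite. *)
Lemma standardized_truncated_cvg {R : realType} (mu : probability R R) : standardized mu ->
  \int[mu]_u Num.min (u ^+ 2) ((Num.sqrt n%:R)^-1 * `|u| ^+ 3) @[n --> \oo] --> (0 : R).
Proof.
move=> [_ mu2 _ _].
pose h n (u : R) := Num.min (u ^+ 2) ((Num.sqrt n%:R)^-1 * `|u| ^+ 3).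
have h0 n u : 0 <= h n u by rewrite le_min sqr_ge0 mulr_ge0// ?invr_ge0 ?exprn_ge0.
have mh n : measurable_fun setT (h n) by exact: measurable_truncated.
rewrite -(_ : fine (\int[mu]_u (cst 0%E u)) = 0); last by rewrite integral0.
apply: fine_cvg; rewrite fineK; last by rewrite integral0.
apply: (@dominated_cvg _ _ _ mu setT measurableT (fun n u => (h n u)%:E) _
  (EFin \o (fun u : R => u ^+ 2))) => //.
- by move=> n; apply/measurable_EFinP.
- move=> u _; apply: cvg_EFin; first exact: nearW.
  have c0 : (Num.sqrt n%:R)^-1 * `|u| ^+ 3 @[n --> \oo] --> (0 : R).
    rewrite -[X in _ --> X](mul0r (`|u| ^+ 3)); apply: cvgMl.
    apply/cvgrPdist_lt => e e0; near=> n.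
    rewrite sub0r normrN ger0_norm ?invr_ge0//.
    rewrite invf_plt ?posrE ?sqrtr_gt0 ?ltr0n//; last by near: n; exists 1%N.
    rewrite -[ltLHS]ger0_norm ?invr_ge0 ?ltW// -sqrtr_sqr ltr_sqrt; last first.
      by rewrite ltr0n; near: n; exists 1%N.
    by near: n; exact: nbhs_infty_gtr.
  apply: squeeze_cvgr c0; last exact: cvg_cst.
  by apply: nearW => n; rewrite h0 ge_min lexx orbT.
- move=> n u _; rewrite /= lee_fin ger0_norm ?h0//.
  by rewrite ge_min lexx.
Unshelve. all: by end_near. Qed.

(** The main term sees [mu] only through its mean and variance, so it is the same for any two
    standardized laws. The factor [1 / n] comes out of the integrated remainder, leaving the
    truncated integral that tends to 0; as that integral does not involve [y], the estimate is
    uniform in [y]. *)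
Lemma taylor_mean {R : realType} (mu : probability R R) (f f1 f2 : R -> R) (K : R) :
  standardized mu -> measurable_fun setT f -> (forall u, 0 <= f u <= 1) -> 0 <= K ->
  (forall y t, `|f (y + t) - f y - t * f1 y - t ^+ 2 / 2 * f2 y|
     <= K * Num.min (t ^+ 2) (`|t| ^+ 3)) ->
  forall e, 0 < e -> \forall n \near \oo, forall y,
    `|\int[mu]_t f (y + (Num.sqrt n%:R)^-1 * t) - f y - n%:R^-1 / 2 * f2 y| <= e / n%:R.
Proof.
move=> smu mf f01 K0 fK e e0.
have K1 : 0 < K + 1 by lra.
(* [K] may be 0, hence the denominator [K + 1]. *)
have eK : 0 < e / (K + 1) by rewrite divr_gt0.
have /cvgrPdist_lt/(_ _ eK) := standardized_truncated_cvg smu.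
apply: filterS2 (nbhs_infty_gt 0) => n n0 + y.
have [mu1 mu2 m1 m2] := smu.
set c := (Num.sqrt n%:R)^-1.
have c0 : 0 <= c by rewrite invr_ge0.
have cc : c ^+ 2 = n%:R^-1 by rewrite exprVn sqr_sqrtr.
set I := Rintegral _ _ _; rewrite sub0r normrN => Ie.
have I0 : 0 <= I.
  by apply: Rintegral_ge0 => u _; rewrite le_min sqr_ge0 mulr_ge0 ?exprn_ge0.
rewrite ger0_norm// in Ie.
have fi : mu.-integrable setT (EFin \o (fun t => f (y + c * t))).
  apply: (@bounded_integrable _ _ _ 1) => [|u].
    by apply: measurableT_comp => //; apply: measurable_funD => //; exact: measurable_funM.
  by have /andP[? ?] := f01 (y + c * u); rewrite ger0_norm.
have ci (a : R) : mu.-integrable setT (EFin \o cst a).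
  exact: (@bounded_integrable _ _ _ `|a|).
have i1 : mu.-integrable setT (EFin \o (fun t => (c * f1 y) * t)).
  by have := integrableZl measurableT (c * f1 y) mu1; apply: eq_integrable.
have i2 : mu.-integrable setT (EFin \o (fun t => (c ^+ 2 / 2 * f2 y) * t ^+ 2)).
  by have := integrableZl measurableT (c ^+ 2 / 2 * f2 y) mu2; apply: eq_integrable.
pose r t := f (y + c * t) - f y - c * f1 y * t - c ^+ 2 / 2 * f2 y * t ^+ 2.
have ri1 : mu.-integrable setT (EFin \o (fun t => f (y + c * t) - f y)).
  by have := integrableB measurableT fi (ci (f y)); apply: eq_integrable.
have ri2 : mu.-integrable setT (EFin \o (fun t => f (y + c * t) - f y - c * f1 y * t)).
  by have := integrableB measurableT ri1 i1; apply: eq_integrable.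
have ri : mu.-integrable setT (EFin \o r).
  by have := integrableB measurableT ri2 i2; apply: eq_integrable.
have -> : \int[mu]_t f (y + c * t) - f y - n%:R^-1 / 2 * f2 y = \int[mu]_t r t.
  rewrite /r RintegralB// RintegralB// RintegralB//.
  rewrite (@RintegralZl _ _ _ mu setT id)// (@RintegralZl _ _ _ mu setT (fun t => t ^+ 2))//.
  by rewrite m1 m2 Rintegral_cst_probability cc mulr1 mulr0 subr0.
  exact: ci.
apply: le_trans (le_normr_Rintegral measurableT ri) _.
pose h (u : R) := Num.min (u ^+ 2) (c * `|u| ^+ 3).
have h0 u : 0 <= h u by rewrite le_min sqr_ge0 mulr_ge0// exprn_ge0.
have mh : measurable_fun setT h by exact: measurable_truncated.
have hi : mu.-integrable setT (EFin \o h).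
  apply: le_integrable mu2 => //; first exact/measurable_EFinP.
  move=> u _; rewrite /= lee_fin !ger0_norm ?sqr_ge0//.
  by rewrite ge_min lexx.
have hi' : mu.-integrable setT (EFin \o (fun u => K / n%:R * h u)).
  by have := integrableZl measurableT (K / n%:R) hi; apply: eq_integrable.
apply: (@le_trans _ _ (\int[mu]_u (K / n%:R * h u))).
  apply: le_Rintegral => //.
    by have := integrable_norm ri; apply: eq_integrable.
  move=> t _; have := fK y (c * t).
  rewrite (_ : f (y + c * t) - _ - _ - _ = r t); last by rewrite /r; ring.
  move=> /le_trans; apply; rewrite -mulrA ler_wpM2l//.
  rewrite minr_pMr ?invr_ge0// -cc exprMn normrM (ger0_norm c0).
  by have -> : (c * `|t|) ^+ 3 = c ^+ 2 * (c * `|t| ^+ 3) by ring.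
rewrite RintegralZl//; rewrite mulrAC ler_wpM2r ?invr_ge0//.
rewrite ltr_pdivlMr// in Ie.
by rewrite -/I; nra.
Qed.

(** * Convolution and partial sums *)

Section conditional_joint_law.
Context {R : realType} {d : measure_display} {T : measurableType d}.
Variables (P : probability T R) (S Y : {RV P >-> R}) (E : set T).
Hypothesis mE : measurable E.
Hypothesis SYE : forall B C : set R, measurable B -> measurable C ->
  P (S @^-1` B `&` (Y @^-1` C `&` E)) = (P (S @^-1` B) * (P (Y @^-1` C) * P E))%E.

Let SY (w : T) : R * R := (S w, Y w).

Let mSY : measurable_fun setT SY.
Proof. exact/measurable_fun_pair. Qed.

HB.instance Definition _ := isMeasurableFun.Build _ _ _ _ SY mSY.

(** The conditional law of the pair given [E] agrees with the product of the marginals on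
    rectangles, hence everywhere by uniqueness of the product measure. The case [E = setT] is the
    usual joint law of two independent variables. *)
Lemma joint_law_indep (D : set (R * R)) : measurable D ->
  P (SY @^-1` D `&` E) = ((distribution P S \x distribution P Y) D * P E)%E.
Proof.
move=> mD.
have mSYD : measurable (SY @^-1` D) by rewrite -[X in measurable X]setTI; exact: mSY.
(* Conditioning on a null event is meaningless, but then both sides are 0. *)
have [E0|E0] := eqVneq (P E) 0%E.
  rewrite E0 mule0; apply/eqP; rewrite -measure_le0 -E0.
  by apply: le_measure; rewrite ?inE//; exact: measurableI.
have PEfin : P E \is a fin_num by exact: fin_num_measure.
have r0 : 0 < fine (P E) by rewrite fine_gt0// lt0e E0 measure_ge0 ltey_eq PEfin.
have k0 : 0 < (fine (P E))^-1 by rewrite invr_gt0.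
pose k' : {nonneg R} := NngNum (ltW k0).
have -> : ((distribution P S \x distribution P Y) D)%E =
    mscale k' (pushforward (mrestr P mE) SY) D.
  move=> ?; apply: product_measure_unique => // B C mB mC.
  rewrite -[LHS]/((fine (P E))^-1%:E * P (SY @^-1` (B `*` C) `&` E))%E.
  have -> : SY @^-1` (B `*` C) `&` E = S @^-1` B `&` (Y @^-1` C `&` E).
    by rewrite setIA.
  rewrite SYE// /distribution /pushforward muleCA; congr (_ * _)%E.
  by rewrite muleCA -[X in (_ * (_ * X))%E]fineK// -EFinM mulVf ?mule1// gt_eqF.
rewrite -[mscale _ _ _]/((fine (P E))^-1%:E * P (SY @^-1` D `&` E))%E.
rewrite muleAC -[X in (_ * X * _)%E]fineK//.
by rewrite -EFinM mulVf ?mul1e// gt_eqF.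
Qed.

End conditional_joint_law.

(** Tested only against continuous functions with values in [0, 1]: the telescoping uses no others,
    and for Gaussian laws continuity gives access to integration by substitution. *)
Definition convolution_of {R : realType} (nu mu rho : probability R R) :=
  forall f : R -> R, continuous f -> (forall u, 0 <= f u <= 1) ->
  (\int[rho]_u (f u)%:E = \int[nu]_s \int[mu]_t (f (s + t))%:E)%E.

Lemma convolution_of_indep {R : realType} {d : measure_display} {T : measurableType d}
    (P : probability T R) (S Y : {RV P >-> R}) :
  (forall B C : set R, measurable B -> measurable C ->
    P (S @^-1` B `&` Y @^-1` C) = (P (S @^-1` B) * P (Y @^-1` C))%E) ->
  convolution_of (distribution P S) (distribution P Y) (distribution P (S + Y)).
Proof.
move=> indSY f cf f01.
have mf : measurable_fun setT f by exact: continuous_measurable_fun.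
pose g (z : R * R) := (f (z.1 + z.2))%:E.
have mg : measurable_fun setT g.
  by apply/measurable_EFinP; apply: measurableT_comp => //; exact: measurable_funD.
have g0 z : (0 <= g z)%E by rewrite lee_fin; case/andP: (f01 (z.1 + z.2)).
rewrite ge0_integral_distribution//; last 2 first.
- by apply/measurable_EFinP.
- by move=> y; rewrite lee_fin; case/andP: (f01 y).
rewrite -[RHS](fubini_tonelli1 g)//.
have mSY : measurable_fun setT (fun w => (S w, Y w)) by exact/measurable_fun_pair.
transitivity (\int[pushforward P (fun w => (S w, Y w))]_z g z)%E.
  by rewrite ge0_integral_pushforward.
apply: eq_measure_integral => D mD _.
have := @joint_law_indep _ _ _ P S Y setT measurableT _ D mD.
rewrite setIT probability_setT mule1; apply => B C mB mC.
by rewrite setIT mule1; exact: indSY.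
Qed.

(** The event that [S + Y] lies in [B] says that the pair lies in a planar set [D].
    [joint_law_indep] is applied to [D] twice: with [E] to split off [P E], with [setT] to recognize
    the law of the sum. *)
Lemma indep_add {R : realType} {d : measure_display} {T : measurableType d}
    (P : probability T R) (S Y : {RV P >-> R}) (E : set T) : measurable E ->
  (forall B C : set R, measurable B -> measurable C ->
    P (S @^-1` B `&` Y @^-1` C) = (P (S @^-1` B) * P (Y @^-1` C))%E) ->
  (forall B C : set R, measurable B -> measurable C ->
    P (S @^-1` B `&` (Y @^-1` C `&` E)) = (P (S @^-1` B) * (P (Y @^-1` C) * P E))%E) ->
  forall B, measurable B ->
    P ((S + Y) @^-1` B `&` E) = (P ((S + Y)%R @^-1` B) * P E)%E.
Proof.
move=> mE indSY indSYE B mB.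
pose D := (fun z : R * R => z.1 + z.2) @^-1` B.
have mD : measurable D.
  rewrite -[D]setTI; apply: (_ : measurable_fun setT _) => //.
  exact: measurable_funD.
rewrite (@joint_law_indep _ _ _ P S Y E mE indSYE D mD); congr (_ * _)%E.
have := @joint_law_indep _ _ _ P S Y setT measurableT _ D mD.
rewrite setIT probability_setT mule1 => <-// A C mA mC.
by rewrite setIT mule1; exact: indSY.
Qed.

(** * Independence of a partial sum from the later variables *)

Section partial_sums.
Context {R : realType} {d : measure_display} {T : measurableType d}.
Variables (P : probability T R) (X : nat -> {RV P >-> R}).
Hypothesis X_indep : mutually_independent X.

(* [partial_sum n] has [n.+1] terms. *)
Definition partial_sum (n : nat) : {RV P >-> R} :=
  \sum_(i < n.+1) (X i : {mfun T >-> R}).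

Lemma partial_sumE n w : partial_sum n w = \sum_(i < n.+1) X i w.
Proof. exact: mfun_sum. Qed.

Lemma partial_sumS n : partial_sum n.+1 = partial_sum n + X n.+1.
Proof. by rewrite /partial_sum big_ord_recr. Qed.

(** Induction on [n] with [J] and [C] general: the hypothesis is used for the singleton of [n.+1],
    which makes the new summand independent of the old sum, and for [J] enlarged by [n.+1], which
    gives the triple product rule required by [indep_add]. *)
Lemma partial_sum_indep n (J : {fset nat}) (C : nat -> set R) :
  (forall i, i \in J -> (n < i)%N) -> (forall i, i \in J -> measurable (C i)) ->
  forall B, measurable B ->
  P (partial_sum n @^-1` B `&` \bigcap_(i in [set` J]) X i @^-1` C i) =
  (P (partial_sum n @^-1` B) * P (\bigcap_(i in [set` J]) X i @^-1` C i))%E.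
Proof.
have cap m (K : {fset nat}) (A : nat -> set R) B : m \notin K ->
    \bigcap_(i in [set` (m |` K)%fset]) X i @^-1` (if i == m then B else A i) =
    X m @^-1` B `&` \bigcap_(i in [set` K]) X i @^-1` A i.
  move=> mK; apply/seteqP; split => w.
    move=> h; split.
      by have := h m; rewrite eqxx; apply; rewrite /= !inE eqxx.
    move=> i iK; have := h i; rewrite /= !inE (negbTE (_ : i != m)).
      by apply; rewrite [in X in is_true X](_ : i \in K) ?orbT.
    by apply: contraNneq mK => <-.
  move=> [hm h] i; rewrite /= !inE.
  by case: eqP => [-> //|_ /= iK]; exact: h.
have mcap (K : {fset nat}) (A : nat -> set R) : (forall i, i \in K -> measurable (A i)) ->
    measurable (\bigcap_(i in [set` K]) X i @^-1` A i).
  move=> mA; apply: fin_bigcap_measurable => [|i iK]; first exact: finite_fset.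
  by rewrite -[X in measurable X]setTI; apply: measurable_funP => //; exact: mA.
(* One variable is split off from a finite family by using the product rule on both families. *)
have ind m (K : {fset nat}) (A : nat -> set R) B : m \notin K ->
    (forall i, i \in K -> measurable (A i)) -> measurable B ->
    P (X m @^-1` B `&` \bigcap_(i in [set` K]) X i @^-1` A i) =
    (P (X m @^-1` B) * P (\bigcap_(i in [set` K]) X i @^-1` A i))%E.
  move=> mK mA mB; rewrite -cap// X_indep; last first.
    by move=> i; rewrite !inE; case: eqP => [->//|_ /=]; exact: mA.
  rewrite X_indep// big_fsetU1//= eqxx; congr (_ * _)%E.
  apply: eq_big_seq => i iK; rewrite ifF//.
  by apply/negbTE; apply: contraNneq mK => <-.
elim: n J C => [|n IH] J C Jn mC B mB.
  rewrite /partial_sum big_ord1 ind//.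
  by apply/negP => /Jn.
have nJ : n.+1 \notin J by apply/negP => /Jn; rewrite ltnn.
rewrite partial_sumS; apply: indep_add => //; first exact: mcap.
- move=> A A' mA mA'.
  have := IH [fset n.+1]%fset (fun=> A') _ _ A mA.
  rewrite (_ : \bigcap_(i in _) _ = X n.+1 @^-1` A'); last first.
    apply/seteqP; split => w; first by apply; rewrite /= !inE.
    by move=> h i; rewrite /= !inE => /eqP ->.
  by move=> H; apply: H => // i; rewrite in_fset1 => /eqP ->.
- move=> A A' mA mA'; rewrite -ind// -cap//; apply: IH => // i.
    by rewrite !inE => /orP[/eqP ->//|/Jn]; exact: ltnW.
  by rewrite !inE; case: eqP => [->//|_ /=]; exact: mC.
Qed.

Lemma convolution_partial_sum n :
  convolution_of (distribution P (partial_sum n)) (distribution P (X n.+1))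
    (distribution P (partial_sum n.+1)).
Proof.
rewrite partial_sumS; apply: convolution_of_indep => B C mB mC.
have := @partial_sum_indep n [fset n.+1]%fset (fun=> C) _ _ B mB.
rewrite (_ : \bigcap_(i in _) _ = X n.+1 @^-1` C); last first.
  apply/seteqP; split => w; first by apply; rewrite /= !inE.
  by move=> h i; rewrite /= !inE => /eqP ->.
by move=> H; apply: H => // i; rewrite in_fset1 => /eqP ->.
Qed.

End partial_sums.

Lemma measurable_Rintegral_param {R : realType} (mu : probability R R) (h : R * R -> R) :
  measurable_fun setT h -> (forall z, 0 <= h z <= 1) ->
  measurable_fun setT (fun s => \int[mu]_t h (s, t)).
Proof.
move=> mh h01; apply: measurableT_comp => //.
apply: (@measurable_fun_fubini_tonelli_F _ _ _ _ _ mu (EFin \o h)).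
  exact/measurable_EFinP.
by move=> z; rewrite lee_fin; case/andP: (h01 z).
Qed.

Lemma EFin_Rintegral_bounded {R : realType} (mu : probability R R) (f : R -> R) :
  measurable_fun setT f -> (forall z, 0 <= f z <= 1) ->
  ((\int[mu]_t f t)%:E = \int[mu]_t (f t)%:E)%E.
Proof.
move=> mf f01; rewrite fineK//; apply: integrable_fin_num => //.
apply: (@bounded_integrable _ _ _ 1) => // u.
by case/andP: (f01 u) => *; rewrite ger0_norm.
Qed.

Lemma Rintegral_bounded01 {R : realType} (mu : probability R R) (f : R -> R) :
  measurable_fun setT f -> (forall z, 0 <= f z <= 1) -> 0 <= \int[mu]_t f t <= 1.
Proof.
move=> mf f01; rewrite Rintegral_ge0/=; last by move=> u _; case/andP: (f01 u).
apply: le_trans (ler_norm _) _; apply: normr_Rintegral_le => // u.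
by case/andP: (f01 u) => *; rewrite ger0_norm.
Qed.

Lemma Rintegral_exchange {R : realType} (nu mu : probability R R) (h : R * R -> R) :
  measurable_fun setT h -> (forall z, 0 <= h z <= 1) ->
  \int[nu]_s \int[mu]_t h (s, t) = \int[mu]_t \int[nu]_s h (s, t).
Proof.
move=> mh h01.
have mhs s : measurable_fun setT (fun t => h (s, t)) by exact: measurableT_comp.
have mht t : measurable_fun setT (fun s => h (s, t)) by exact: measurableT_comp.
rewrite /Rintegral.
under eq_integral do rewrite EFin_Rintegral_bounded//.
under [in RHS]eq_integral do rewrite EFin_Rintegral_bounded//.
congr fine; apply: (@fubini_tonelli _ _ _ _ _ nu mu (EFin \o h)).
  exact/measurable_EFinP.
by move=> z; rewrite lee_fin; case/andP: (h01 z).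
Qed.

Lemma convolution_ofR {R : realType} (nu mu rho : probability R R) (f : R -> R) :
  convolution_of nu mu rho -> continuous f -> (forall u, 0 <= f u <= 1) ->
  \int[rho]_u f u = \int[nu]_s \int[mu]_t f (s + t).
Proof.
move=> conv cf f01; rewrite /Rintegral conv//; congr fine.
apply: eq_integral => s _; rewrite -EFin_Rintegral_bounded//.
apply: measurableT_comp; first exact: continuous_measurable_fun.
exact: measurable_funD.
Qed.

(* [nu k] and [rho k] are the [k.+1]-fold convolution powers of [mu] and [ga]. One
   step replaces the last factor [mu] by [ga]; exchanging the order of integration
   then moves that [ga] outside, where the induction hypothesis applies. *)
Lemma convolution_telescope {R : realType} (mu ga : probability R R)
    (nu rho : nat -> probability R R) (f : R -> R) (c eta : R) :
  continuous f -> (forall u, 0 <= f u <= 1) -> nu 0%N = mu -> rho 0%N = ga ->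
  (forall k, convolution_of (nu k) mu (nu k.+1)) ->
  (forall k, convolution_of (rho k) ga (rho k.+1)) ->
  (forall y, `|\int[mu]_t f (y + c * t) - \int[ga]_t f (y + c * t)| <= eta) ->
  forall k y, `|\int[nu k]_u f (y + c * u) - \int[rho k]_u f (y + c * u)| <= k.+1%:R * eta.
Proof.
move=> cf f01 nu0 rho0 cnu crho close; elim=> [|k IH] y.
  by rewrite nu0 rho0 mul1r.
have mf : measurable_fun setT f by exact: continuous_measurable_fun.
have cfy : continuous (fun u => f (y + c * u)).
  move=> u; apply: (@continuous_comp _ _ _ (fun u : R => y + c * u) f); last exact: cf.
  by apply: cvgD; [exact: cvg_cst|apply: cvgMr; exact: cvg_id].
pose A (m : probability R R) s := \int[m]_t f (s + c * t).
pose h (z : R * R) := f (y + c * z.1 + c * z.2).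
have mh : measurable_fun setT h.
  apply: measurableT_comp => //; apply: measurable_funD; last exact: measurable_funM.
  by apply: measurable_funD => //; exact: measurable_funM.
have h01 z : 0 <= h z <= 1 by exact: f01.
have mA m : measurable_fun setT (fun s => A m (y + c * s)).
  exact: (measurable_Rintegral_param m mh h01).
have A01 m s : 0 <= A m s <= 1.
  apply: Rintegral_bounded01 => //.
  by apply: measurableT_comp => //; apply: measurable_funD => //; exact: measurable_funM.
(* The operators of two laws commute, by Tonelli and commutativity of addition. *)
have swap (m m' : probability R R) : \int[m]_s A m' (y + c * s) = \int[m']_s A m (y + c * s).
  rewrite (Rintegral_exchange m m' mh h01); apply: eq_Rintegral => t _.
  by apply: eq_Rintegral => s _; rewrite /h addrAC.
have step (m m' m'' : probability R R) : convolution_of m m' m'' ->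
    \int[m'']_u f (y + c * u) = \int[m]_s A m' (y + c * s).
  move=> conv; rewrite (convolution_ofR conv)//.
  apply: eq_Rintegral => s _; apply: eq_Rintegral => t _.
  by rewrite mulrDr addrA.
have int01 (m : probability R R) (a : R -> R) :
    measurable_fun setT a -> (forall u, 0 <= a u <= 1) -> m.-integrable setT (EFin \o a).
  move=> ma a01; apply: (@bounded_integrable _ m _ 1) => // u.
  by case/andP: (a01 u) => *; rewrite ger0_norm.
have diff (m : probability R R) (a b : R -> R) e :
    measurable_fun setT a -> measurable_fun setT b ->
    (forall u, 0 <= a u <= 1) -> (forall u, 0 <= b u <= 1) ->
    (forall u, `|a u - b u| <= e) -> `|\int[m]_u a u - \int[m]_u b u| <= e.
  move=> ma mb a01 b01 abe; rewrite -RintegralB//; [|exact: int01|exact: int01].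
  by apply: normr_Rintegral_le => //; exact: measurable_funB.
rewrite (step _ _ _ (cnu k)) (step _ _ _ (crho k)) [in X in _ - X]swap.
(* The intermediate term combines [nu k] with one factor [ga]. It differs from the first term by an
   integral against [nu k], bounded by [close], and from the second by an integral against [ga],
   bounded by [IH]. *)
rewrite -(subrKA (\int[nu k]_s A ga (y + c * s))) [X in _ + (X - _)]swap.
apply: le_trans (ler_normD _ _) _; rewrite -[k.+2%:R]natr1 mulrDl mul1r addrC.
by apply: lerD; apply: diff => // u; [exact: IH|exact: close].
Qed.

(** * Gaussian laws *)

Section gaussian_laws.
Context {R : realType}.
Local Notation leb := (@lebesgue_measure R).

Let idR (x : measurableTypeR R) : R := x.

HB.instance Definition _ :=
  @isMeasurableFun.Build _ _ (measurableTypeR R) R idR (@measurable_id _ R setT).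

(* [normal_prob] is a measure on [measurableTypeR R], whose display differs from that
   of [R], hence the transport along the identity. *)
Definition gaussian (s : R) : probability R R := distribution (normal_prob 0 s) idR.

Lemma gaussianE (s : R) (B : set R) :
  gaussian s B = (\int[leb]_(t in B) (normal_pdf 0 s t)%:E)%E.
Proof. by []. Qed.

(** The Radon-Nikodym derivative and [normal_pdf 0 s] have the same integral over every measurable
    set, so they agree almost everywhere. *)
Lemma ge0_integral_gaussian (s : R) (f : R -> \bar R) :
  measurable_fun setT f -> (forall x, 0 <= f x)%E ->
  (\int[gaussian s]_x f x = \int[leb]_x (f x * (normal_pdf 0 s x)%:E))%E.
Proof.
move=> mf f0; rewrite ge0_integral_distribution//.
have dom := normal_prob_dominates (0 : R) s.
rewrite -(Radon_Nikodym_SigmaFinite.change_of_variables dom)//.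
apply: ae_eq_integral => //.
- apply: emeasurable_funM => //; apply: measurable_int.
  exact: Radon_Nikodym_SigmaFinite.f_integrable.
- apply: emeasurable_funM => //; apply/measurable_EFinP.
  exact: measurable_normal_pdf.
- apply: ae_eqe_mul2l; apply: integral_ae_eq => //.
  + exact: Radon_Nikodym_SigmaFinite.f_integrable.
  + by apply/measurable_EFinP; exact: measurable_normal_pdf.
  + by move=> E _ mE; rewrite -Radon_Nikodym_SigmaFinite.f_integral.
Qed.

(** One substitution serves both translations ([a = 1]) and dilations ([b = 0]). *)
Lemma ge0_integral_affine (G : R -> R) (a b : R) : 0 < a -> continuous G ->
  (forall x, 0 <= G x) ->
  (\int[leb]_x (G x)%:E = \int[leb]_x (G ((x + b) * a) * a)%:E)%E.
Proof.
move=> a0 cG G0.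
have dF (x : R) : is_derive x 1 (fun x : R => (x + b) * a) a.
  apply: is_derive_eq; rewrite scaler0 add0r addr0; exact: mulr1.
have F'E : (fun x : R => (x + b) * a)^`()%classic = cst a.
  by apply/funext => x; rewrite derive1E; apply: derive_val.
rewrite (@increasing_ge0_integration_by_substitutionT _ (fun x => (x + b) * a))//.
- by apply: eq_integral => x _; rewrite F'E.
- by move=> x y xy; rewrite ltr_pM2r// ltrD2r.
- by rewrite F'E => ?; exact: cvg_cst.
- by rewrite F'E; exact: is_cvg_cst.
- by rewrite F'E; exact: is_cvg_cst.
- by apply/gt0_cvgMlNy => //; exact: cvg_addrr_Ny.
- by apply/gt0_cvgMly => //; exact: cvg_addrr.
Qed.

(* Completing the square: prior times likelihood is marginal times posterior. *)
Lemma normal_pdf_mul (a b u s : R) : 0 < a -> 0 < b ->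
  normal_pdf 0 a s * normal_pdf 0 b (u - s) =
  normal_pdf 0 (Num.sqrt (a ^+ 2 + b ^+ 2)) u *
  normal_pdf (u * a ^+ 2 / (a ^+ 2 + b ^+ 2)) (a * b / Num.sqrt (a ^+ 2 + b ^+ 2)) s.
Proof.
move=> a0 b0; set c2 := a ^+ 2 + b ^+ 2; set c := Num.sqrt c2.
have c20 : 0 < c2 by rewrite addr_gt0// exprn_gt0.
have c0 : 0 < c by rewrite sqrtr_gt0.
have cc : c ^+ 2 = c2 by rewrite sqr_sqrtr// ltW.
have [[a0' b0'] c0'] := (ltW a0, ltW b0, ltW c0).
have abc0 : 0 < a * b / c by rewrite divr_gt0// mulr_gt0.
rewrite !normal_pdfE ?gt_eqF// /normal_peak /normal_fun.
rewrite mulrACA [RHS]mulrACA -!expRD; congr (_ * expR _).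
  rewrite -!invfM -!sqrtrM ?mulrn_wge0 ?mulr_ge0 ?sqr_ge0 ?pi_ge0//.
  congr (Num.sqrt _)^-1; rewrite !exprMn exprVn cc.
  by field; rewrite gt_eqF.
rewrite !exprMn exprVn cc /c2; field.
rewrite -/c2 ?gt_eqF//.
Qed.

(** With [u = s + t] as new variable and the order of integration exchanged, [normal_pdf_mul] splits
    the product of densities: the factor depending on [s] integrates to 1, the other is the density
    of the claimed law at [u]. *)
Lemma convolution_gaussian (a b : R) : 0 < a -> 0 < b ->
  convolution_of (gaussian a) (gaussian b) (gaussian (Num.sqrt (a ^+ 2 + b ^+ 2))).
Proof.
move=> a0 b0 f cf f01; set c := Num.sqrt _.
have mf : measurable_fun setT f by exact: continuous_measurable_fun.
have f0 u : 0 <= f u by case/andP: (f01 u).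
have mfD : measurable_fun setT (fun z : R * R => (f (z.1 + z.2))%:E).
  by apply/measurable_EFinP; apply: measurableT_comp => //; exact: measurable_funD.
have inner s : (\int[gaussian b]_t (f (s + t))%:E =
    \int[leb]_u (f u * normal_pdf 0 b (u - s))%:E)%E.
  rewrite ge0_integral_gaussian; last 2 first.
  - by apply/measurable_EFinP; apply: measurableT_comp => //; exact: measurable_funD.
  - by move=> t; rewrite lee_fin.
  rewrite [RHS](@ge0_integral_affine _ 1 s)//; last 2 first.
  - move=> u; apply: cvgM; first exact: cf.
    apply: (@continuous_comp _ _ _ (fun u : R => u - s) (normal_pdf 0 b)).
      by apply: cvgB; [exact: cvg_id|exact: cvg_cst].
    by apply: continuous_normal_pdf; rewrite gt_eqF.
  - by move=> u; rewrite mulr_ge0// normal_pdf_ge0.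
  by apply: eq_integral => t _; rewrite !mulr1 addrK [t + s]addrC EFinM.
rewrite ge0_integral_gaussian//; last exact/measurable_EFinP.
rewrite [RHS]ge0_integral_gaussian; last 2 first.
- apply: (@measurable_fun_fubini_tonelli_F _ _ _ _ _ (gaussian b) _ mfD).
  by move=> z; rewrite lee_fin.
- by move=> s; apply: integral_ge0 => t _; rewrite lee_fin.
under [RHS]eq_integral do rewrite inner.
pose h (z : R * R) := normal_pdf 0 a z.1 * normal_pdf 0 b (z.2 - z.1).
have mh : measurable_fun setT h.
  apply: measurable_funM; apply: measurableT_comp => //.
  - exact: measurable_normal_pdf.
  - exact: measurable_normal_pdf.
  - exact: measurable_funB.
have h0 z : 0 <= h z by rewrite mulr_ge0// normal_pdf_ge0.
transitivity (\int[leb]_s \int[leb]_u ((f u * h (s, u))%:E))%E; last first.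
  apply: eq_integral => s _.
  rewrite -ge0_integralZr//; last 3 first.
  - apply/measurable_EFinP/measurable_funM => //.
    by apply: measurableT_comp; [exact: measurable_normal_pdf|exact: measurable_funB].
  - by move=> u _; rewrite lee_fin mulr_ge0// normal_pdf_ge0.
  - by rewrite lee_fin normal_pdf_ge0.
  by apply: eq_integral => u _; rewrite -EFinM /h/= -mulrA [normal_pdf 0 b _ * _]mulrC.
transitivity (\int[leb]_u \int[leb]_s (f u * h (s, u))%:E)%E; last first.
  apply: (@fubini_tonelli _ _ _ _ _ leb leb (fun z => (f z.1 * h (z.2, z.1))%:E)).
    apply/measurable_EFinP/measurable_funM; first exact: measurableT_comp.
    by apply: measurableT_comp => //; apply/measurable_fun_pair.
  by move=> z; rewrite lee_fin mulr_ge0.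
apply: eq_integral => u _ /=.
under [RHS]eq_integral do rewrite /h/= normal_pdf_mul// mulrA EFinM.
rewrite ge0_integralZl//; last 3 first.
- by apply/measurable_EFinP; exact: measurable_normal_pdf.
- by move=> s _; rewrite lee_fin normal_pdf_ge0.
- by rewrite lee_fin mulr_ge0// normal_pdf_ge0.
by rewrite integral_normal_pdf mule1.
Qed.

(** Under the substitution by [a * u] the Jacobian [a] cancels against the change of [normal_peak].
    This brings the law of a Gaussian sum back to [gaussian 1]. *)
Lemma gaussian_scale (a s : R) (f : R -> R) : 0 < a -> s != 0 -> continuous f ->
  (forall u, 0 <= f u <= 1) ->
  (\int[gaussian (a * s)]_u (f u)%:E = \int[gaussian s]_u (f (a * u))%:E)%E.
Proof.
move=> a0 s0 cf f01; have f0 u : 0 <= f u by case/andP: (f01 u).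
have as0 : a * s != 0 by rewrite mulf_neq0// gt_eqF.
have mf : measurable_fun setT f by exact: continuous_measurable_fun.
rewrite [RHS]ge0_integral_gaussian; last 2 first.
- by apply/measurable_EFinP; apply: measurableT_comp => //; exact: measurable_funM.
- by move=> u; rewrite lee_fin.
rewrite [LHS]ge0_integral_gaussian//; last exact/measurable_EFinP.
under eq_integral do rewrite -EFinM.
rewrite (@ge0_integral_affine _ a 0)//; last 2 first.
- by move=> u; apply: cvgM; [exact: cf|exact: continuous_normal_pdf].
- by move=> u; rewrite mulr_ge0// normal_pdf_ge0.
apply: eq_integral => u _; rewrite addr0 [u * a]mulrC -EFinM -mulrA; congr (_ * _)%:E.
rewrite !normal_pdfE// /normal_peak /normal_fun !subr0 mulrAC; congr (_ * expR _).
  rewrite exprMn -mulrA -mulrnAr sqrtrM ?sqr_ge0// sqrtr_sqr gtr0_norm//.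
  by rewrite invfM mulrAC mulVf ?mul1r// gt_eqF.
by rewrite !exprMn; field; rewrite s0 gt_eqF.
Qed.

End gaussian_laws.

(** * Moments of the standard Gaussian law *)

Section standard_gaussian_moments.
Context {R : realType}.
Local Notation leb := (@lebesgue_measure R).
Local Notation phi := (normal_pdf (0 : R) 1).

Lemma is_derive_normal_pdf01 (t : R) : is_derive t 1 phi (- (t * phi t)).
Proof.
have -> : phi = fun t => (Num.sqrt (2 * pi))^-1 * expR (- (t ^+ 2 / 2)).
  by apply/funext => u; rewrite normal_pdf01E mulrC.
have dg : is_derive t 1 (fun t : R => - (t ^+ 2 / 2)) (- t).
  apply: is_derive_eq; rewrite !scaler0 add0r; congr (- _).
  by rewrite -[LHS]/(2^-1 * (t * 1 + t * 1)); field.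
have de := @is_derive1_comp _ expR (fun t : R => - (t ^+ 2 / 2)) t _ _ (is_derive_expR _) dg.
have dk := is_deriveZ (Num.sqrt (2 * pi))^-1 de.
rewrite (_ : - _ = (Num.sqrt (2 * pi))^-1 *: (expR (- (t ^+ 2 / 2)) * - t)); first exact: dk.
by rewrite /GRing.scale/=; ring.
Qed.

Lemma is_derive_mul_normal_pdf01 (t : R) :
  is_derive t 1 (fun t => t * phi t) (phi t - t ^+ 2 * phi t).
Proof.
have dp := is_derive_normal_pdf01 t.
apply: is_derive_eq; by rewrite /GRing.scale/=; ring.
Qed.

(** From [expR (t ^+ 2 / 2) >= t ^+ 2 / 2] it follows that [t * phi t <= 2 * k / t], where [k] is
    the peak of the density. *)
Lemma cvg_mul_normal_pdf01 : t * phi t @[t --> +oo] --> (0 : R).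
Proof.
set k := normal_peak (1 : R); have k0 : 0 < k by exact: normal_peak_gt0.
apply/cvgrPdist_lt => e e0; near=> t.
have t0 : 0 < t by near: t; exact: nbhs_pinfty_gt.
rewrite sub0r normrN ger0_norm; last by rewrite mulr_ge0 ?normal_pdf_ge0// ltW.
have te : 2 * k / e < t by near: t; apply: nbhs_pinfty_gt; exact: num_real.
apply: le_lt_trans (_ : 2 * k / t < e); last first.
  by rewrite ltr_pdivrMr// -ltr_pdivrMl// mulrC.
rewrite normal_pdfE ?oner_neq0// /normal_fun -/k subr0 expr1n mulNr expRN.
rewrite ler_pdivlMr// mulrAC -expr2.
have ex : t ^+ 2 / 2 <= expR (t ^+ 2 / 2).
  by apply: le_trans (expR_ge1Dx _); rewrite lerDr.
have ep := expR_gt0 (t ^+ 2 / 2).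
rewrite [_ *+ 2]mulr2n -[1 + 1]/2%:R mulrCA [leRHS]mulrC ler_pM2l//.
by rewrite ler_pdivrMr// -ler_pdivrMl// mulrC.
Unshelve. all: by end_near. Qed.

Lemma continuous_phi : continuous phi.
Proof. by apply: continuous_normal_pdf; exact: oner_neq0. Qed.

Let sq (t : R) := t ^+ 2 * phi t.

Let continuous_sq : continuous sq.
Proof.
by move=> t; apply: cvgM; [exact: exprn_continuous|exact: continuous_phi].
Qed.

Let phi0 t : 0 <= phi t. Proof. exact: normal_pdf_ge0. Qed.

Let sq0 t : 0 <= sq t. Proof. by rewrite mulr_ge0// sqr_ge0. Qed.

Let msq D : measurable D -> measurable_fun D (EFin \o sq).
Proof.
by move=> mD; apply/measurable_EFinP/measurable_funTS; exact: continuous_measurable_fun.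
Qed.

Let mphi D : measurable D -> measurable_fun D (EFin \o phi).
Proof.
by move=> mD; apply/measurable_EFinP/measurable_funTS; exact: measurable_normal_pdf.
Qed.

(* [t * phi t] is an antiderivative of [(1 - t ^+ 2) * phi t], which changes sign at
   [1]: splitting [0, +oo[ there leaves integrands of constant sign. *)
Let derivable_mul (t : R) : derivable (fun t : R => t * phi t) t 1.
Proof. by have [] := is_derive_mul_normal_pdf01 t. Qed.

Let continuous_mul : continuous (fun t : R => t * phi t).
Proof. by move=> t; apply: cvgM; [exact: cvg_id|exact: continuous_phi]. Qed.

Let derive_mul : (fun t => t * phi t)^`()%classic = (fun t => phi t - sq t).
Proof.
by apply/funext => t; rewrite derive1E; have [] := is_derive_mul_normal_pdf01 t.
Qed.

Let itg01 : (\int[leb]_(t in `[0%R, 1%R]) (phi t)%:E =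
  \int[leb]_(t in `[0%R, 1%R]) (sq t)%:E + (phi 1)%:E)%E.
Proof.
have FTC : (\int[leb]_(t in `[0%R, 1%R]) (phi t - sq t)%:E = (phi 1)%:E)%E.
  rewrite (@continuous_FTC2 _ _ (fun t => t * phi t))//.
  - by rewrite mul1r mul0r sube0.
  - apply: continuous_subspaceT => t; apply: cvgB; first exact: continuous_phi.
    exact: continuous_sq.
  - split=> [t _||]; first exact: derivable_mul.
      by apply: cvg_at_right_filter; exact: continuous_mul.
    by apply: cvg_at_left_filter; exact: continuous_mul.
  - by move=> t _; rewrite derive_mul.
rewrite -FTC -ge0_integralD//=.
- by apply: eq_integral => t _; rewrite -EFinD addrC subrK.
- by move=> t _; rewrite lee_fin sq0.
- exact: msq.
- move=> t; rewrite in_itv/= => /andP[t0 t1].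
  by rewrite lee_fin subr_ge0 ler_piMl// exprn_ile1.
- apply/measurable_EFinP/measurable_funB.
    by apply/measurable_EFinP; exact: mphi.
  by apply/measurable_EFinP; exact: msq.
Qed.

Let itg1y : (\int[leb]_(t in `[1%R, +oo[) (sq t)%:E =
  \int[leb]_(t in `[1%R, +oo[) (phi t)%:E + (phi 1)%:E)%E.
Proof.
have FTC : (\int[leb]_(t in `[1%R, +oo[) (sq t - phi t)%:E = (phi 1)%:E)%E.
  rewrite (@ge0_continuous_FTC2y _ _ (fun t => - (t * phi t)) _ 0)//.
  - by rewrite mul1r sub0e EFinN oppeK.
  - by move=> t t1; rewrite subr_ge0 ler_peMl// exprn_ege1.
  - apply: continuous_subspaceT => t; apply: cvgB; last exact: continuous_phi.
    exact: continuous_sq.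
  - by rewrite -[X in _ --> X]oppr0; apply: cvgN; exact: cvg_mul_normal_pdf01.
  - by move=> t _; apply: derivableN; exact: derivable_mul.
  - by apply: cvg_at_right_filter; apply: cvgN; exact: continuous_mul.
  - move=> t _; rewrite derive1N; last exact: derivable_mul.
    by rewrite derive_mul opprB.
rewrite -FTC -ge0_integralD//=.
- by apply: eq_integral => t _; rewrite -EFinD addrC subrK.
- by move=> t _; rewrite lee_fin phi0.
- exact: mphi.
- move=> t; rewrite in_itv/= andbT => t1.
  by rewrite lee_fin subr_ge0 ler_peMl// exprn_ege1.
- apply/measurable_EFinP/measurable_funB.
    by apply/measurable_EFinP; exact: msq.
  by apply/measurable_EFinP; exact: mphi.
Qed.

(** By evenness it suffices to compare [sq] and [phi] on the half-line. The excess of [phi] over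
    [sq] on [0, 1] and that of [sq] over [phi] beyond 1 are both [phi 1], so the two integrals
    agree. *)
Lemma integral_sqr_normal_pdf01 : (\int[leb]_t (t ^+ 2 * phi t)%:E = 1)%E.
Proof.
have split (g : R -> R) : continuous g -> (forall t, 0 <= g t) ->
    (\int[leb]_(t in [set t | (0 <= t)%R]) (g t)%:E =
     \int[leb]_(t in `[0%R, 1%R]) (g t)%:E + \int[leb]_(t in `[1%R, +oo[) (g t)%:E)%E.
  move=> cg g0; have mg D : measurable D -> measurable_fun D (EFin \o g).
    by move=> mD; apply/measurable_EFinP/measurable_funTS; exact: continuous_measurable_fun.
  (* Removing the endpoint 1 from the second interval makes the pieces disjoint. *)
  rewrite -(@integral_itv_obnd_cbnd _ 1); last exact: mg.
  rewrite -ge0_integral_setU//=; last 3 first.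
  - by apply: mg; exact: measurableU.
  - by move=> t _; rewrite lee_fin.
  - apply/disj_setPS => t [] /=; rewrite !in_itv/= andbT => /andP[_ t1].
    by rewrite ltNge t1.
  congr integral; apply/seteqP; split => t /=; rewrite !in_itv/= andbT.
    by move=> t0; have [?|?] := leP t 1; [left; rewrite t0|right].
  by move=> [/andP[]//|t1]; exact: le_trans (ltW t1).
rewrite -(integral_normal_pdf (0 : R) 1).
rewrite (ge0_symfun_integralT sq0 continuous_sq); last first.
  by move=> t; rewrite /sq/= sqrrN !normal_pdf01E sqrrN.
rewrite (ge0_symfun_integralT phi0 continuous_phi); last first.
  by move=> t; rewrite /= !normal_pdf01E sqrrN.
congr (_ * _)%E; rewrite split// split//; last exact: continuous_phi.
by rewrite itg01 itg1y addeAC addeA.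
Qed.

End standard_gaussian_moments.

(** Since the square of [|u| - 1] is nonnegative, [1 + u ^+ 2] dominates [|u|]. *)
Lemma integrable_id_of_sqr {R : realType} (mu : probability R R) :
  mu.-integrable setT (EFin \o (fun u : R => u ^+ 2)) ->
  mu.-integrable setT (EFin \o (@id R)).
Proof.
move=> i2; have i1 : mu.-integrable setT (EFin \o (fun u : R => 1 + u ^+ 2)).
  have c1 : mu.-integrable setT (EFin \o cst (1 : R)).
    by apply: (@bounded_integrable _ _ _ 1) => // u; rewrite normr1.
  by have := integrableD measurableT c1 i2; apply: eq_integrable.
apply: le_integrable i1 => //; first exact/measurable_EFinP.
move=> u _; rewrite /= lee_fin [leRHS]ger0_norm; last by rewrite addr_ge0 ?sqr_ge0.
rewrite -[u ^+ 2]real_normK ?num_real//; have := sqr_ge0 (`|u| - 1).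
by have := normr_ge0 u; rewrite sqrrB; nra.
Qed.

(** The density is even, so the law is invariant under negation and its mean equals its own
    opposite. *)
Lemma integral_id_gaussian1 {R : realType} :
  (gaussian 1).-integrable setT (EFin \o (@id R)) -> \int[gaussian 1]_u u = 0 :> R.
Proof.
move=> gi; set phi := normal_pdf (0 : R) 1.
have mopp : measurable_fun setT (-%R : R -> R) by exact: oppr_measurable.
have sym (B : set R) : measurable B -> gaussian 1 (-%R @^-1` B) = gaussian 1 B.
  move=> mB; rewrite !gaussianE.
  transitivity (\int[lebesgue_measure]_(t in -%R @^-1` B) ((EFin \o phi) \o -%R) t)%E.
    by apply: eq_integral => t _; rewrite /= /phi !normal_pdf01E sqrrN.
  transitivity (\int[pushforward lebesgue_measure
      (-%R : measurableTypeR R -> measurableTypeR R)]_(t in B) (EFin \o phi) t)%E.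
    rewrite ge0_integral_pushforward//.
      by apply/measurable_EFinP/measurable_funTS; exact: measurable_normal_pdf.
    by move=> t _; rewrite lee_fin normal_pdf_ge0.
  by apply: eq_measure_integral => A mA _; exact: lebesgue_measureN.
have : \int[gaussian 1]_u u = - \int[gaussian 1]_u u :> R.
  rewrite -mulN1r -RintegralZl//; congr fine.
  transitivity (\int[pushforward (gaussian 1) (-%R : R -> R)]_u u%:E)%E.
    by apply: eq_measure_integral => A mA _; exact: (esym (sym A mA)).
  rewrite integral_pushforward//.
    by apply: eq_integral => u _; rewrite mulN1r.
  have := integrableN gi; apply: eq_integrable => //.
by lra.
Qed.

Lemma standardized_gaussian1 {R : realType} : standardized (@gaussian R 1).
Proof.
have i2E : (\int[gaussian 1]_u (u ^+ 2)%:E = 1 :> \bar R)%E.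
  rewrite ge0_integral_gaussian; last 2 first.
  - by apply/measurable_EFinP; exact: measurable_funX.
  - by move=> u; rewrite lee_fin sqr_ge0.
  by under eq_integral do rewrite -EFinM; exact: integral_sqr_normal_pdf01.
have i2 : (gaussian 1).-integrable setT (EFin \o (fun u : R => u ^+ 2)).
  apply/integrableP; split; first by apply/measurable_EFinP; exact: measurable_funX.
  under eq_integral do rewrite /= ger0_norm ?sqr_ge0//.
  by rewrite i2E ltry.
have i1 : (gaussian 1).-integrable setT (EFin \o (@id R)).
  exact: integrable_id_of_sqr.
split => //; first exact: integral_id_gaussian1.
by rewrite /Rintegral i2E.
Qed.

(** * Convergence *)

Section law_bounds.
Context {R : realType}.
Implicit Types (m : probability R R) (A : set R) (f : R -> R).

Let Rintegral_indic m A : measurable A -> \int[m]_u \1_A u = fine (m A).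
Proof. by move=> mA; rewrite /Rintegral integral_indic// setIT. Qed.

Let le_Rintegral01 m (f g : R -> R) : measurable_fun setT f -> measurable_fun setT g ->
  (forall u, 0 <= f u <= 1) -> (forall u, 0 <= g u <= 1) -> (forall u, f u <= g u) ->
  \int[m]_u f u <= \int[m]_u g u.
Proof.
move=> mf mg f01 g01 fg; apply: le_Rintegral => //.
  apply: (@bounded_integrable _ m _ 1) => // u.
  by case/andP: (f01 u) => *; rewrite ger0_norm.
apply: (@bounded_integrable _ m _ 1) => // u.
by case/andP: (g01 u) => *; rewrite ger0_norm.
Qed.

Let indic01 A u : 0 <= (\1_A u : R) <= 1.
Proof. by rewrite indicE; case: (u \in A); rewrite /= ?lexx ?ler01. Qed.

Lemma measure_le_Rintegral m A f : measurable A -> measurable_fun setT f ->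
  (forall u, 0 <= f u <= 1) -> (forall u, A u -> f u = 1) -> fine (m A) <= \int[m]_u f u.
Proof.
move=> mA mf f01 fA; rewrite -Rintegral_indic//; apply: le_Rintegral01 => // u.
rewrite indicE; have [/set_mem/fA ->//|_] := boolP (u \in A).
by case/andP: (f01 u).
Qed.

Lemma Rintegral_le_measure m A f : measurable A -> measurable_fun setT f ->
  (forall u, 0 <= f u <= 1) -> (forall u, ~ A u -> f u = 0) -> \int[m]_u f u <= fine (m A).
Proof.
move=> mA mf f01 fA; rewrite -Rintegral_indic//; apply: le_Rintegral01 => // u.
rewrite indicE; have [_|/negP uA] := boolP (u \in A).
  by case/andP: (f01 u).
by rewrite fA// => /mem_set.
Qed.

(** The added interval has length [h], and the density never exceeds its peak. *)
Lemma gaussian1_cdf_lipschitz (x h : R) : 0 <= h ->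
  fine (gaussian 1 [set u | u <= x + h]) <=
  fine (gaussian 1 [set u | u <= x]) + h * normal_peak 1.
Proof.
move=> h0; have mI (i : interval R) : measurable [set` i] by exact: measurable_itv.
have gf A : measurable A -> gaussian (1 : R) A \is a fin_num by move=> ?; exact: fin_num_measure.
have E (y : R) : [set u | u <= y] = `]-oo, y]%classic.
  by apply/seteqP; split => u /=; rewrite in_itv.
rewrite !E -lee_fin EFinD !fineK ?gf//.
have -> : `]-oo, (x + h)]%classic = `]-oo, x]%classic `|` `]x, (x + h)]%classic :> set R.
  apply/seteqP; split => u /=; rewrite !in_itv/=.
    by move=> ux; have [?|?] := leP u x; [left|right].
  by move=> [ux|/andP[]//]; rewrite (le_trans ux)// lerDl.
apply: le_trans (measureU2 _ (mI _) (mI _)) _; rewrite leeD2l//.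
rewrite [leLHS](_ : _ =
  \int[lebesgue_measure]_(t in `]x, (x + h)%R]) (normal_pdf 0 1 t)%:E)%E//.
have ub : (\int[lebesgue_measure]_(t in `]x, (x + h)%R]) (normal_pdf 0 1 t)%:E <=
    \int[lebesgue_measure]_(t in `]x, (x + h)%R]) (normal_peak (1 : R))%:E)%E.
  apply: ge0_le_integral => //.
  - by move=> t _; rewrite lee_fin normal_pdf_ge0.
  - by apply/measurable_EFinP/measurable_funTS; exact: measurable_normal_pdf.
  - by move=> t _; rewrite lee_fin normal_pdf_ub// oner_neq0.
apply: le_trans ub _.
rewrite integral_cst//= lebesgue_measure_itv/= lte_fin ltrDl.
case: ifPn => [_|_]; last by rewrite mule0 lee_fin mulr_ge0// normal_peak_ge0.
by rewrite -EFinD addrAC subrr add0r -EFinM mulrC.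
Qed.

End law_bounds.

(** * Convergence for smooth test functions *)

Section smooth_convergence.
Context {R : realType} {d : measure_display} {T : measurableType d}.
Variables (P : probability T R) (X : nat -> {RV P >-> R}).
Hypothesis X_indep : mutually_independent X.
Hypothesis X_iddist : identically_distributed X.
Hypothesis X_mean : forall i : nat, ('E_P[X i] = 0)%E.
Hypothesis X_var : forall i : nat, ('V_P[X i] = 1)%E.

Lemma standardized_law : standardized (distribution P (X 0%N)).
Proof.
have i2E : (\int[distribution P (X 0%N)]_u (u ^+ 2)%:E = 1)%E.
  rewrite ge0_integral_distribution; last 2 first.
  - by apply/measurable_EFinP; exact: measurable_funX.
  - by move=> u; rewrite lee_fin sqr_ge0.
  rewrite -(X_var 0%N) /variance unlock X_mean/= unlock.
  apply: eq_integral => w _.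
  by rewrite -[RHS]/(((X 0%N w - 0) * (X 0%N w - 0))%:E) subr0 expr2.
have i2 : (distribution P (X 0%N)).-integrable setT (EFin \o (fun u : R => u ^+ 2)).
  apply/integrableP; split; first by apply/measurable_EFinP; exact: measurable_funX.
  under eq_integral do rewrite /= ger0_norm ?sqr_ge0//.
  by rewrite i2E ltry.
have i1 := integrable_id_of_sqr i2.
split => //; last by rewrite /Rintegral i2E.
have i1P : P.-integrable setT (EFin \o X 0%N).
  apply/integrableP; split; first exact/measurable_EFinP.
  have /integrableP[_] := i1; rewrite ge0_integral_distribution//.
  by apply: measurableT_comp => //; exact/measurable_EFinP.
rewrite /Rintegral integral_distribution//.
by have := X_mean 0%N; rewrite unlock => ->.
Qed.

(** The laws of [X n.+1] and [X 0] are known to agree on measurable sets only, so they are exchanged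
    under the integral. *)
Lemma convolution_partial_sum0 n :
  convolution_of (distribution P (partial_sum X n)) (distribution P (X 0%N))
    (distribution P (partial_sum X n.+1)).
Proof.
move=> f cf f01; rewrite (convolution_partial_sum X_indep)//.
apply: eq_integral => s _; apply: eq_measure_integral => A mA _.
exact: X_iddist.
Qed.

Lemma smooth_test_cvg (f : R -> R) : smooth_test f -> forall e, 0 < e ->
  \forall n \near \oo,
  `|\int[distribution P (partial_sum X n)]_u f ((Num.sqrt n.+1%:R)^-1 * u)
    - \int[gaussian 1]_u f u| <= e.
Proof.
move=> sf e e0; have [cf f01 _] := sf.
have mf : measurable_fun setT f by exact: continuous_measurable_fun.
have [f1 [f2 [K K0 fK]]] := smooth_test_taylor sf.
(* One half for each law: both are compared with the same Taylor main term. *)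
have e2 : 0 < e / 2 by rewrite divr_gt0.
have nearX := taylor_mean standardized_law mf f01 K0 fK e2.
have nearG := taylor_mean standardized_gaussian1 mf f01 K0 fK e2.
have [N1 _ HX] := nearX; have [N2 _ HG] := nearG.
exists (maxn N1 N2) => // n /=; rewrite geq_max => /andP[N1n N2n].
have n0 : (0 : R) < Num.sqrt n.+1%:R by rewrite sqrtr_gt0 ltr0n.
have -> : \int[gaussian 1]_u f u =
    \int[gaussian (Num.sqrt n.+1%:R)]_u f ((Num.sqrt n.+1%:R)^-1 * u).
  have cfc : continuous (fun u => f ((Num.sqrt n.+1%:R)^-1 * u)).
    move=> u; apply: (@continuous_comp _ _ _ (fun u : R => (Num.sqrt n.+1%:R)^-1 * u) f).
      by apply: cvgMr; exact: cvg_id.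
    exact: cf.
  have := gaussian_scale n0 (oner_neq0 R) cfc (fun u => f01 _).
  rewrite mulr1 /Rintegral => ->; congr fine; apply: eq_integral => u _.
  by rewrite mulKf// gt_eqF.
(* The index [n] stands for [n.+1] factors, so an error of [e / n.+1] per replacement adds up to
   [e]. *)
have := @convolution_telescope _ (distribution P (X 0%N)) (gaussian 1)
  (fun k => distribution P (partial_sum X k)) (fun k => gaussian (Num.sqrt k.+1%:R))
  f (Num.sqrt n.+1%:R)^-1 (e / n.+1%:R) cf f01 _ _ convolution_partial_sum0 _ _ n 0.
rewrite mulrCA mulfV ?mulr1 ?pnatr_eq0//.
under eq_Rintegral do rewrite add0r.
under [X in _ - X]eq_Rintegral do rewrite add0r.
apply.
- by congr distribution; rewrite /partial_sum big_ord1.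
- by rewrite sqrtr1.
- move=> k; have -> : Num.sqrt k.+2%:R =
      Num.sqrt (Num.sqrt k.+1%:R ^+ 2 + 1 ^+ 2) :> R.
    by rewrite sqr_sqrtr// expr1n natr1.
  by apply: convolution_gaussian; rewrite ?sqrtr_gt0 ?ltr0n.
move=> y.
set a := \int[_]_t _; set b := \int[_]_t _.
have := HX n.+1 (leqW N1n) y; have := HG n.+1 (leqW N2n) y.
rewrite -/a -/b !ler_norml; move: (n.+1%:R^-1) => r.
by move=> /andP[? ?] /andP[? ?]; apply/andP; split; lra.
Qed.

End smooth_convergence.

Unset Implicit Arguments.

Theorem theorem1 (R : realType)
    (d : measure_display) (Omega : measurableType d) (P : probability Omega R)
    (X : nat -> {RV P >-> R})
    (X_indep : mutually_independent X)
    (X_iddist : identically_distributed X)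
    (X_mean : forall i : nat, ('E_P[X i] = 0)%E)
    (X_var : forall i : nat, ('V_P[X i] = 1)%E)
    (d' : measure_display) (Omega' : measurableType d')
    (P' : probability Omega' R) (Z : {RV P' >-> R})
    (Z_normal : standard_normal Z) :
  forall x : R,
    P [set w | (\sum_(i < n) X i w) / Num.sqrt n%:R <= x] @[n --> \oo]
      --> P' [set w | Z w <= x].
Proof.
move=> x; have mle1 (b : R) : measurable [set u : R | u <= b].
  by rewrite (_ : [set _ | _] = `]-oo, b]%classic).
have mle (a b : R) : measurable [set u : R | a * u <= b].
  rewrite (_ : [set _ | _] = ( *%R a) @^-1` [set u | u <= b])//.
  by rewrite -[X in measurable X]setTI; exact: measurable_funM.
have -> : P' [set w | Z w <= x] = gaussian 1 [set u | u <= x].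
  exact: (Z_normal [set u | u <= x]).
rewrite -[X in _ --> X]fineK; last exact: fin_num_measure.
(* The shift matches the [n.+1] terms of [partial_sum n] and discards the degenerate index 0. *)
rewrite -(cvg_shiftS (fun n => P [set w | (\sum_(i < n) X i w) / Num.sqrt n%:R <= x])).
pose c n : R := (Num.sqrt n.+1%:R)^-1.
have PE n : P [set w | (\sum_(i < n.+1) X i w) / Num.sqrt n.+1%:R <= x] =
    distribution P (partial_sum X n) [set u | c n * u <= x].
  congr (P _); apply/seteqP; split => w /=; rewrite partial_sumE mulrC//.
under eq_fun do rewrite PE.
apply/fine_cvgP; split; first by apply: nearW => n; exact: fin_num_measure.
apply/cvgrPdist_le => e e0.
have k0 : 0 < normal_peak (1 : R) by rewrite normal_peak_gt0// oner_neq0.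
set k := normal_peak 1 in k0 *.
(* The test functions fall from 1 to 0 over a length [3 * h]; with this [h] the Gaussian mass of
   such an interval is at most [e / 2]. *)
pose h := e / (6 * k); have h0 : 0 < h by rewrite divr_gt0// mulr_gt0.
have hk : 3 * h * k = e / 2 by rewrite /h; field; rewrite gt_eqF.
pose f (a u : R) := spline (- h^-1 * u + a / h).
have sf a : smooth_test (f a) by exact: smooth_test_spline.
have f01 a u : 0 <= f a u <= 1 by exact: spline01.
have mf a : measurable_fun setT (f a).
  by apply: continuous_measurable_fun; case: (sf a).
have fE a u : f a u = spline ((a - u) / h).
  by congr spline; rewrite mulrBl mulNr addrC [h^-1 * u]mulrC.
have f0 a u : a <= u -> f a u = 0.
  by move=> au; rewrite fE spline_le0// ler_pdivrMr// mul0r subr_le0.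
have f1 a u : u <= a - 3 * h -> f a u = 1.
  by move=> au; rewrite fE spline_ge3// ler_pdivlMr//; lra.
have e2 : 0 < e / 2 by rewrite divr_gt0.
have cvgf := smooth_test_cvg X_indep X_iddist X_mean X_var (sf _) e2.
(* [f (x + 3 * h)] lies above the indicator of [u <= x] and [f x] below it. Each side loses [e / 2]
   in passing to the Gaussian integral and [e / 2] in returning to the distribution function at
   [x]. *)
apply: filterS2 (cvgf (x + 3 * h)) (cvgf x) => n.
rewrite -/(c n) /=; set F := fine (distribution P (partial_sum X n) _).
set I1 := \int[distribution _ _]_u _; set J1 := \int[gaussian 1]_u _ => IJ1.
set I0 := \int[distribution _ _]_u _; set J0 := \int[gaussian 1]_u _ => IJ0.
have mfc a : measurable_fun setT (fun u => f a (c n * u)).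
  by apply: measurableT_comp => //; exact: measurable_funM.
have FI1 : F <= I1.
  by apply: measure_le_Rintegral => // u /= cu; rewrite f1//; lra.
have IF0 : I0 <= F.
  by apply: Rintegral_le_measure => // u /= /negP; rewrite -ltNge => /ltW; exact: f0.
have JG1 : J1 <= fine (gaussian 1 [set u | u <= x + 3 * h]).
  by apply: Rintegral_le_measure => // u /= /negP; rewrite -ltNge => /ltW; exact: f0.
have GJ0 : fine (gaussian 1 [set u | u <= x - 3 * h]) <= J0.
  by apply: measure_le_Rintegral => // u /= cu; rewrite f1.
have h30 : 0 <= 3 * h by rewrite mulr_ge0// ltW.
have := gaussian1_cdf_lipschitz x h30.
have := gaussian1_cdf_lipschitz (x - 3 * h) h30.
rewrite subrK -/k hk; move: IJ1 IJ0; rewrite !ler_norml.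
by move=> /andP[? ?] /andP[? ?] ? ?; apply/andP; split; lra.
Qed.
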